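(* There is an infinite family of $3$-connected planar graphs with maximum degree $4$, girth $4$ and injective chromatic number $6$.
   Context: All graphs are simple. The girth is the length of a shortest cycle. An injective $k$-colouring of $G$ is a map $c:V(G)\to\{1,\dots,k\}$ such that any two distinct vertices with a common neighbour get different colours; the injective chromatic number $\chi_i(G)$ is the least such $k$. *)

(* Defs.v *)
From mathcomp Require Import all_boot all_order all_algebra.
From mathcomp Require Import all_classical all_reals all_analysis.

Set Implicit Arguments.
Unset Strict Implicit.
Unset Printing Implicit Defensive.

Import Order.TTheory GRing.Theory Num.Theory.
Import numFieldNormedType.Exports.

Local Open Scope classical_set_scope.
Local Open Scope ring_scope.

Record sgraph := SGraph {
  vertex :> finType;
  adj : rel vertex;
  adj_sym : symmetric adj;
  adj_irrefl : irreflexive adj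
}.

Definition isomorphic (G H : sgraph) : Prop :=
  exists2 f : G -> H, bijective f & forall x y, adj (f x) (f y) = adj x y.

Definition max_degree (G : sgraph) : nat := (\max_(x : G) #|adj x|)%N.

Definition is_cycle (G : sgraph) (p : seq G) : bool :=
  ucycleb (@adj G) p && (2 < size p)%N.

(* A relation rather than a function: an acyclic graph has no girth in nat. *)
Definition has_girth (G : sgraph) (g : nat) : Prop :=
  (exists2 p : seq G, is_cycle p & size p = g) /\
  (forall p : seq G, is_cycle p -> (g <= size p)%N).

Definition k_connected (k : nat) (G : sgraph) : Prop :=
  (k < #|G|)%N /\
  forall S : {set G}, (#|S| < k)%N -> forall x y : G, x \notin S -> y \notin S ->
    connect [rel u v | [&& adj u v, u \notin S & v \notin S]] x y.

Definition injective_colouring (G : sgraph) (k : nat) (c : {ffun G -> 'I_k}) :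
    bool :=
  [forall x, forall y,
    (x != y) && [exists z, adj z x && adj z y] ==> (c x != c y)].

Definition injectively_colourable (G : sgraph) (k : nat) : bool :=
  [exists c : {ffun G -> 'I_k}, injective_colouring c].

Lemma injectively_colourable_ex (G : sgraph) :
  exists k, injectively_colourable G k.
Proof.
exists #|G|; apply/existsP; exists [ffun x => enum_rank x].
apply/forallP => x; apply/forallP => y; apply/implyP => /andP[xy _].
by rewrite !ffunE (inj_eq enum_rank_inj).
Qed.

Definition injective_chromatic_number (G : sgraph) : nat :=
  ex_minn (injectively_colourable_ex G).

Definition is_arc (R : realType) (A : set (R * R)) (a b : R * R) : Prop :=
  exists f : R -> R * R,
    [/\ {within `[0, 1], continuous f},
        {in `[0, 1] &, injective f},
        f 0 = a, f 1 = b & f @` `[0, 1] = A].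

(* The edge xy is drawn as the arc A x y = A y x; an edge meets the vertex
   points only in its two ends, and distinct edges meet only in vertex points.
   Values of A on non-adjacent pairs are irrelevant. *)
Definition planar (R : realType) (G : sgraph) : Prop :=
  exists (p : G -> R * R) (A : G -> G -> set (R * R)),
    [/\ injective p,
        forall x y, adj x y -> is_arc (A x y) (p x) (p y) /\ A x y = A y x,
        forall x y z, adj x y -> A x y (p z) -> z = x \/ z = y &
        forall x y z w, adj x y -> adj z w ->
          ~ (x = z /\ y = w) -> ~ (x = w /\ y = z) ->
          A x y `&` A z w `<=` range p].

(* Main.v *)
Require Import Defs.
From mathcomp Require Import all_boot all_order all_algebra.
From mathcomp Require Import all_classical all_reals all_analysis.
From mathcomp Require Import ring lra.

(* Three vertices a, b, c of degree 4 with neighbourhoods {1,2,3,4}, {1,2,5,6}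
   and {3,4,5,6} make 1, ..., 6 pairwise conflicting, so 6 colours are needed.
   Placing 1, 3, 5 inside and 2, 4, 6 outside the hexagon through a, b, c,
   joining 1, 3, 5 to a central vertex and 2, 4, 6 to the innermost of at least
   three nested 6-cycles gives a "spider web": vertices lie on six rays from the
   origin and edges run along a ray or between consecutive rays.  The web is
   bipartite with a 4-cycle; it is coloured periodically along the rays; and the
   number of nested 6-cycles is arbitrary.  For 3-connectivity, two removed
   vertices miss one of the 6-cycles, one of any three rays, and one of three
   disjoint paths from a given inner vertex to the innermost 6-cycle. *)

Set Implicit Arguments.
Unset Strict Implicit.
Unset Printing Implicit Defensive.

(* The pair (i, r) stands for the point at distance r on the i-th ray; the centre
   is (0, 0).  The vertices 1, 3, 5 have r = 1, a, b, c have r = 2, and 2, 4, 6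
   have r = 3; the nested 6-cycles are r = 4, 5, ... *)
Definition core : seq (nat * nat) :=
  [:: (0, 0); (0, 1); (2, 1); (4, 1); (1, 2); (3, 2); (5, 2);
      (0, 3); (2, 3); (4, 3)].

Definition valid (p : nat * nat) : bool :=
  (p \in core) || (p.1 < 6) && (3 < p.2).

Definition turn (i j : nat) : nat := (i + j) %% 6.

(** [turn i 1] and [turn i 5] are the next and the previous ray. There is no outermost cycle: this
    is the infinite web, from which the finite ones are cut. At radius 4 only the even rays continue
    inwards. *)
Definition nb (p : nat * nat) : seq (nat * nat) :=
  let: (i, r) := p in let a := turn i 1 in let b := turn i 5 in
  match r with
  | 0 => [:: (0, 1); (2, 1); (4, 1)]
  | 1 => [:: (0, 0); (a, 2); (b, 2)]
  | 2 => [:: (a, 1); (b, 1); (a, 3); (b, 3)]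
  | 3 => [:: (a, 2); (b, 2); (i, 4)]
  | r'.+1 => [:: (a, r); (b, r); (i, r.+1)] ++
             (if (r == 4) && odd i then [::] else [:: (i, r')])
  end.

(** A bipartition of the web. Edges between radius 2 and radii 1 or 3 change both the ray and the
    radius, hence the flip at radius 2. *)
Definition side (p : nat * nat) : bool := odd (p.1 + p.2) (+) (p.2 == 2).

(* The three colours 3 * odd r + {0, 1, 2} serve the cycle of radius r; they are
   rotated by one step between radii r and r + 2. *)
Definition colour (p : nat * nat) : nat :=
  if 3 < p.2 then 3 * odd p.2 + (p.1./2 + odd p.2./2) %% 3
  else nth 0 [:: 0; 0; 1; 2; 2; 3; 1; 4; 5; 3] (index p core).

(** * Local checks in the infinite web *)

Lemma lt6P (P : nat -> Prop) :
  P 0 -> P 1 -> P 2 -> P 3 -> P 4 -> P 5 -> forall i, i < 6 -> P i.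
Proof. by move=> ? ? ? ? ? ? [|[|[|[|[|[|]]]]]]. Qed.

Lemma valid_case (P : nat * nat -> Prop) :
    (forall p, p \in core -> P p) ->
    (forall i k, i < 6 -> P (i, k.+4)) ->
  forall p, valid p -> P p.
Proof.
move=> Pc Pr [i r] /orP[/Pc //|/=].
by case: r => [|[|[|[|k]]]]; rewrite ?andbF // andbT => /Pr.
Qed.

Lemma nb_ok (u : nat * nat) : valid u ->
  all (fun v => [&& valid v, u \in nb v & side u != side v]) (nb u).
Proof.
elim/valid_case => {u} [u|i k i6].
  by move: u; apply/allP; vm_compute.
move: i i6; apply: lt6P; case: k => [|k] //=.
all: rewrite /valid /side !inE /= ?eqxx ?orbT ?andbT //=.
all: by rewrite ?xpair_eqE ?eqxx ?orbT ?andbT //=; case: (odd k).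
Qed.

Lemma size_nb (u : nat * nat) : size (nb u) <= 4.
Proof. by case: u => i [|[|[|[|[|k]]]]] //=; case: ifP. Qed.

Lemma colour_lt6 (u : nat * nat) : valid u -> colour u < 6.
Proof.
elim/valid_case => {u} [u|i k i6].
  by move: u; apply/allP; vm_compute.
rewrite /colour /=; have := ltn_pmod (i./2 + ~~ ~~ odd k./2) (isT : 0 < 3).
by case: (_ %% _) => [|[|[|]]] // _; case: (~~ _).
Qed.

(** At radius above 4, the two neighbours on the cycle use one triple of colours and differ in
    [i./2] modulo 3; the two on the ray use the other triple and differ by the rotation. *)
Lemma uniq_colour_nb (u : nat * nat) : valid u -> uniq (map colour (nb u)).
Proof.
elim/valid_case => {u} [u|i k i6].
  by move: u; apply/allP; vm_compute.
case: k => [|k]; first by move: i i6; apply: lt6P; vm_compute.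
move: i i6; apply: lt6P; rewrite /colour /= uphalf_half !oddD !oddb.
all: by case: (odd k); case: (odd k./2).
Qed.

(** * The finite webs *)

Definition web_vertex (n : nat) : finType := ('I_10 + 'I_n.+3 * 'I_6)%type.

Definition pos (n : nat) (v : web_vertex n) : nat * nat :=
  match v with
  | inl g => nth (0, 0) core g
  | inr (y, x) => (val x, y.+4)
  end.

Lemma pos_valid n (v : web_vertex n) : valid (pos v).
Proof.
case: v => [g|[y x]]; rewrite /valid; last by rewrite /= ltn_ord orbT.
by rewrite mem_nth.
Qed.

Lemma pos_lt n (v : web_vertex n) : (pos v).2 < n + 7.
Proof.
case: v => [g|[y x]] /=; last first.
  by rewrite -[7]/(3 + 4) addnA -addn4 ltn_add2r addn3 ltn_ord.
suff: all (fun p => p.2 < 7) core.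
  move/allP => h; exact: ltn_addl (h _ (mem_nth _ _)).
by [].
Qed.

Lemma pos_inj n : injective (@pos n).
Proof.
have core_lt g : g < 10 -> (nth (0, 0) core g).2 < 4.
  by move=> g10; apply: (allP (isT : all (fun p => p.2 < 4) core)); rewrite mem_nth.
case=> [g|[y x]] [h|[z w]] /=.
- move/eqP; rewrite nth_uniq ?ltn_ord //.
  by move/eqP/val_inj => ->.
- by move=> e; have := core_lt g (ltn_ord g); rewrite e.
- by move=> e; have := core_lt h (ltn_ord h); rewrite -e.
- by case=> /val_inj -> /val_inj ->.
Qed.

Lemma pos_surj n p : valid p -> p.2 < n + 7 -> exists v : web_vertex n, pos v = p.
Proof.
elim/valid_case => {p} [p pc _|i k i6 /=].
  have lt : index p core < 10 by rewrite -[10]/(size core) index_mem.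
  by exists (inl (Ordinal lt)); rewrite /= nth_index.
rewrite -[7]/(3 + 4) addnA -addn4 ltn_add2r addn3 => kn.
by exists (inr (Ordinal kn, Ordinal i6)).
Qed.

(** An induced subgraph of the infinite web: points at radius n + 7 listed by [nb] are the position
    of no vertex and drop out. *)
Definition web_adj (n : nat) : rel (web_vertex n) :=
  [rel u v | pos v \in nb (pos u)].

Lemma web_adj_sym n : symmetric (@web_adj n).
Proof.
suff H u v : @web_adj n u v -> web_adj v u by move=> u v; apply/idP/idP; apply: H.
by move=> /(allP (nb_ok (pos_valid u)))/and3P[].
Qed.

Lemma web_side n (u v : web_vertex n) :
  web_adj u v -> side (pos u) != side (pos v).
Proof. by move=> /(allP (nb_ok (pos_valid u)))/and3P[]. Qed.

Lemma web_adj_irrefl n : irreflexive (@web_adj n).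
Proof. by move=> u; apply/negP => /web_side; rewrite eqxx. Qed.

Definition web (n : nat) : sgraph := SGraph (@web_adj_sym n) (@web_adj_irrefl n).

Lemma card_web n : #|web n| = 10 + n.+3 * 6.
Proof. by rewrite /= card_sum card_prod !card_ord. Qed.

Lemma web_not_isomorphic i j : i <> j -> ~ isomorphic (web i) (web j).
Proof.
move=> ij [f /bij_eq_card]; rewrite !card_web => /addnI/eqP.
by rewrite eqn_pmul2r // !eqSS => /eqP.
Qed.

(** * Maximum degree, girth and injective chromatic number *)

Lemma web_max_degree n : max_degree (web n) = 4.
Proof.
rewrite /max_degree; apply/eqP; rewrite eqn_leq; apply/andP; split.
  apply/bigmax_leqP => u _; rewrite cardE -(size_map (@pos n)).
  apply: leq_trans (size_nb (pos u)); apply: uniq_leq_size.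
    by rewrite (map_inj_uniq (@pos_inj n)) enum_uniq.
  by move=> p /mapP[v]; rewrite mem_enum => uv ->.
pose g k (H : k < 10) : web n := inl (Ordinal H).
(* Index 4 in [core] is the vertex a = (1, 2); indices 1, 2, 7, 8 are its four neighbours. *)
apply: leq_trans (leq_bigmax (@g 4 isT)).
pose s := [:: @g 1 isT; @g 2 isT; @g 7 isT; @g 8 isT].
have us : uniq s by [].
rewrite -[leqLHS]/(size s) -(card_uniqP us); apply: subset_leq_card.
by apply/fintype.subsetP => x; rewrite !inE; do 3?[case/orP]; move/eqP->.
Qed.

Lemma web_girth n : has_girth (web n) 4.
Proof.
pose g k (H : k < 10) : web n := inl (Ordinal H).
split.
  (* The common neighbours (0, 1) and (0, 3) of (1, 2) and (5, 2) close a 4-cycle. *)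
  by exists [:: @g 1 isT; @g 4 isT; @g 7 isT; @g 6 isT].
move=> p; rewrite /is_cycle /ucycleb => /andP[/andP[+ _]].
case: p => [|x [|y [|z [|t p]]]] //= /and4P[xy yz zx _] _.
(* Only a triangle is left to exclude, and a bipartite graph has none. *)
move: (web_side xy) (web_side yz) (web_side zx).
by case: (side (pos x)); case: (side (pos y)); case: (side (pos z)).
Qed.

Lemma uniq_map_inj_in (T1 T2 : eqType) (f : T1 -> T2) (s : seq T1) :
  uniq (map f s) -> {in s &, injective f}.
Proof.
move=> us x y xs ys fxy; have /(uniqP (f x)) inj := us.
rewrite -(nth_index x xs) -(nth_index x ys); congr nth.
apply: inj; rewrite ?inE ?size_map ?index_mem //.
by rewrite !(nth_map x) ?index_mem // !nth_index.
Qed.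

Lemma web_injectively_colourable n : injectively_colourable (web n) 6.
Proof.
apply/existsP; exists [ffun v => Ordinal (colour_lt6 (pos_valid v))].
apply/forallP => x; apply/forallP => y; apply/implyP => /andP[xy].
case/existsP => z /andP[zx zy]; rewrite !ffunE -val_eqE /=.
apply: contra_neq xy => cxy; apply: pos_inj.
exact: (uniq_map_inj_in (uniq_colour_nb (pos_valid z))).
Qed.

Lemma web_injective_chromatic_number n : injective_chromatic_number (web n) = 6.
Proof.
rewrite /injective_chromatic_number; case: ex_minnP => k.
move=> /existsP[c /forallP c_inj] k_min.
apply/eqP; rewrite eqn_leq k_min ?web_injectively_colourable //=.
pose g k (H : k < 10) : web n := inl (Ordinal H).
(* The six vertices at radii 1 and 3; any two share a neighbour among the three at radius 2, which
   have indices 4, 5, 6. *)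
pose s := [:: @g 1 isT; @g 2 isT; @g 3 isT; @g 7 isT; @g 8 isT; @g 9 isT].
have cs : pairwise (fun x y => c x != c y) s.
  have conf x y z : x != y -> adj z x && adj z y -> c x != c y.
    move=> xy zxy; apply: (implyP (forallP (c_inj x) y)); rewrite xy.
    by apply/existsP; exists z.
  suff: pairwise (fun x y => (x != y) && has (fun z => adj z x && adj z y)
      [:: @g 4 isT; @g 5 isT; @g 6 isT]) s.
    by apply: sub_pairwise => x y /andP[xy /hasP[z _]]; apply: conf.
  by [].
have us : uniq (map c s) by rewrite uniq_pairwise pairwise_map.
by rewrite -[k]card_ord -[6]/(size (map c s)) -(card_uniqP us) max_card.
Qed.

(** * 3-connectivity *)

(** Pigeonhole: three disjoint sets all meeting B would give B three distinct elements. It is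
    applied to cycles, to rays and to the paths of a fan. *)
Lemma avoid_one_of_three (T : eqType) (B : seq T) (P1 P2 P3 : pred T) :
  size B <= 2 ->
  (forall x, [/\ ~~ (P1 x && P2 x), ~~ (P1 x && P3 x) & ~~ (P2 x && P3 x)]) ->
  [\/ ~~ has P1 B, ~~ has P2 B | ~~ has P3 B].
Proof.
move=> B2 dis.
case: (boolP (has P1 B)) => [/hasP[x xB x1]|]; last by constructor 1.
case: (boolP (has P2 B)) => [/hasP[y yB y2]|]; last by constructor 2.
case: (boolP (has P3 B)) => [/hasP[z zB z3]|]; last by constructor 3.
suff: size [:: x; y; z] <= size B by rewrite leqNgt (leq_ltn_trans B2).
apply: uniq_leq_size; last by move=> t; rewrite !inE => /or3P[]/eqP->.
rewrite /= !inE negb_or !andbT -andbA; apply/and3P; split.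
- by apply: contraTneq x1 => ->; case: (dis y); rewrite y2 andbT.
- by apply: contraTneq x1 => ->; case: (dis z); rewrite z3 !andbT.
- by apply: contraTneq y2 => ->; case: (dis z); rewrite z3 !andbT.
Qed.

(* Three paths from p to the cycle of radius 4, disjoint except in p. *)
Definition fan (p : nat * nat) :
    seq (nat * nat) * seq (nat * nat) * seq (nat * nat) :=
  let: (i, r) := p in let t := turn i in
  match r with
  | 0 => ([:: (0, 1); (1, 2); (2, 3); (2, 4)],
          [:: (2, 1); (3, 2); (4, 3); (4, 4)],
          [:: (4, 1); (5, 2); (0, 3); (0, 4)])
  | 1 => ([:: (t 1, 2); (t 2, 3); (t 2, 4)],
          [:: (t 5, 2); (i, 3); (i, 4)],
          [:: (0, 0); (t 4, 1); (t 3, 2); (t 4, 3); (t 4, 4)])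
  | 2 => ([:: (t 5, 3); (t 5, 4)],
          [:: (t 1, 3); (t 1, 4)],
          [:: (t 5, 1); (t 4, 2); (t 3, 3); (t 3, 4)])
  | _ => ([:: (i, 4)],
          [:: (t 1, 2); (t 2, 3); (t 2, 4)],
          [:: (t 5, 2); (t 4, 3); (t 4, 4)])
  end.

(** The start p is left out of s, so that fan paths can be disjoint as lists. Radii below 5 keep
    them inside every finite web. *)
Definition core_exit (p : nat * nat) (s : seq (nat * nat)) : bool :=
  [&& path (fun u v => v \in nb u) p s, all valid s,
      all (fun q => q.2 < 5) s & (last p s).2 == 4].

Lemma fanP p : p \in core ->
  let: (s1, s2, s3) := fan p in
  [&& core_exit p s1, core_exit p s2, core_exit p s3,
      ~~ has (mem s1) s2, ~~ has (mem s1) s3 & ~~ has (mem s2) s3].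
Proof. by move: p; apply/allP; vm_compute. Qed.

Section Connectivity.
Variables (n : nat) (S : {set web n}).
Hypothesis S2 : #|S| < 3.

Let e : rel (web n) := [rel u v | [&& adj u v, u \notin S & v \notin S]].
Let B : seq (nat * nat) := [seq pos v | v <- enum S].

Let sizeB : size B <= 2. Proof. by rewrite size_map -cardE. Qed.

Let memB (u : web n) : (pos u \in B) = (u \in S).
Proof. by rewrite (mem_map (@pos_inj n)) mem_enum. Qed.

Let good p := [&& valid p, p.2 < n + 7 & p \notin B].

Let good_pos (u : web n) : u \notin S -> good (pos u).
Proof. by move=> uS; rewrite /good pos_valid pos_lt memB. Qed.

(** Holds vacuously if p or q is the position of no vertex, so transitivity asks for a [good] middle
    point. *)
Let conn p q := forall u v : web n, pos u = p -> pos v = q -> connect e u v.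

Let conn_refl p : conn p p.
Proof. by move=> u v <- /pos_inj ->; apply: connect0. Qed.

Let conn_sym p q : conn p q -> conn q p.
Proof.
move=> pq u v up vq; have e_sym : symmetric e.
  by move=> x y; rewrite /e /= web_adj_sym [(x \notin S) && _]andbC.
by rewrite (sym_connect_sym e_sym); apply: pq.
Qed.

Let conn_trans q p r : good q -> conn p q -> conn q r -> conn p r.
Proof.
move=> /and3P[vq ltq _] pq qr u v up vr.
have [w wq] := pos_surj vq ltq.
exact: connect_trans (pq u w up wq) (qr w v wq vr).
Qed.

Let conn_step p q : good p -> good q -> q \in nb p -> conn p q.
Proof.
move=> /and3P[_ _ pB] /and3P[_ _ qB] pq u v up vq; apply: connect1.
by rewrite /e /= -!memB up vq pB qB /web_adj /= up vq pq.
Qed.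

Let conn_path p s : good p -> all good s ->
  path (fun u v => v \in nb u) p s -> conn p (last p s).
Proof.
elim: s p => [|q s IHs] p gp //= /andP[gq gs] /andP[pq qs].
by apply: (conn_trans gq); [apply: conn_step | apply: IHs].
Qed.

Let good_ring i k : i < 6 -> k < n.+3 -> (i, k.+4) \notin B -> good (i, k.+4).
Proof.
move=> i6 kn kB; rewrite /good kB /valid i6 orbT /= andbT.
by rewrite -addn4 -[7]/(3 + 4) addnA ltn_add2r addn3.
Qed.

Let column_up i k m : i < 6 -> k + m < n.+3 -> ~~ has (fun p => p.1 == i) B ->
  conn (i, k.+4) (i, (k + m).+4).
Proof.
move=> i6 + /hasPn iB.
have gd s : s < n.+3 -> good (i, s.+4).
  by move=> sn; apply: good_ring => //; apply/negP => /iB /=; rewrite eqxx.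
elim: m => [|m IHm]; first by rewrite addn0.
rewrite addnS => km; apply: (@conn_trans (i, (k + m).+4)).
- exact: gd (ltnW km).
- exact: IHm (ltnW km).
apply: conn_step; rewrite ?gd ?(ltnW km) //.
by rewrite /= !inE eqxx !orbT.
Qed.

Let column_conn i k m : i < 6 -> k < n.+3 -> m < n.+3 ->
  ~~ has (fun p => p.1 == i) B -> conn (i, k.+4) (i, m.+4).
Proof.
move=> i6 kn mn iB; case/orP: (leq_total k m) => [km|mk].
  by have := @column_up i k (m - k); rewrite subnKC // => /(_ i6 mn iB).
apply: conn_sym.
by have := @column_up i m (k - m); rewrite subnKC // => /(_ i6 kn iB).
Qed.

Let row_conn k i : i < 6 -> k < n.+3 -> ~~ has (fun p => p.2 == k.+4) B ->
  conn (0, k.+4) (i, k.+4).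
Proof.
move=> + kn /hasPn kB.
have gd j : j < 6 -> good (j, k.+4).
  by move=> j6; apply: good_ring => //; apply/negP => /kB /=; rewrite eqxx.
elim: i => [|i IHi] i6; first exact: conn_refl.
apply: (conn_trans (gd i (ltnW i6))); first exact: IHi (ltnW i6).
apply: conn_step; rewrite ?gd ?(ltnW i6) //.
by rewrite /= !inE /turn addn1 modn_small // eqxx.
Qed.

(** Among the ray of the point and the two adjacent rays, one avoids B. Step onto it along the cycle
    if necessary, follow it to the intact cycle of radius k + 4, and go round to ray 0. *)
Let ring_conn k i m : i < 6 -> k < n.+3 -> ~~ has (fun p => p.2 == k.+4) B ->
  m < n.+3 -> (i, m.+4) \notin B -> conn (0, k.+4) (i, m.+4).
Proof.
move=> i6 kn kB mn mB.
have via j : good (j, m.+4) -> conn (j, m.+4) (i, m.+4) ->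
    j < 6 -> ~~ has (fun p => p.1 == j) B -> conn (0, k.+4) (i, m.+4).
  move=> gj ji j6 jB; apply: (conn_trans gj) => //.
  have gk : good (j, k.+4).
    apply: good_ring => //; apply: contra kB => jk.
    by apply/hasP; exists (j, k.+4) => /=.
  by apply: (conn_trans gk); [apply: row_conn | apply: column_conn].
have beside j : j < 6 -> (j, m.+4) \in nb (i, m.+4) ->
    ~~ has (fun p => p.1 == j) B -> conn (0, k.+4) (i, m.+4).
  move=> j6 ij jB; have gj : good (j, m.+4).
    apply: good_ring => //; apply: contra jB => jm.
    by apply/hasP; exists (j, m.+4) => /=.
  apply: (via j) => //; apply: conn_sym; apply: conn_step => //.
  exact: good_ring.
have dis : forall p : nat * nat,
   [/\ ~~ ((p.1 == i) && (p.1 == turn i 1)), ~~ ((p.1 == i) && (p.1 == turn i 5))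
    & ~~ ((p.1 == turn i 1) && (p.1 == turn i 5))].
  case=> j ? /=; split; apply/negP => /andP[/eqP->];
    by move: i i6 {mB via beside}; apply: lt6P.
case: (avoid_one_of_three sizeB dis) => free.
- by apply: (via i) => //; exact: good_ring.
- by apply: (beside _ _ _ free); rewrite ?ltn_pmod //= !inE eqxx.
- by apply: (beside _ _ _ free); rewrite ?ltn_pmod //= !inE eqxx orbT.
Qed.

Let free_row : exists2 k, k < n.+3 & ~~ has (fun p => p.2 == k.+4) B.
Proof.
have dis : forall p : nat * nat,
   [/\ ~~ ((p.2 == 4) && (p.2 == 5)), ~~ ((p.2 == 4) && (p.2 == 6))
    & ~~ ((p.2 == 5) && (p.2 == 6))].
  by case=> ? j; split; apply/negP => /andP[/eqP->].
by case: (avoid_one_of_three sizeB dis) => free; [exists 0 | exists 1 | exists 2].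
Qed.

(** Some path of the fan of p avoids B and leads to radius 4, where [ring_conn] takes over. *)
Let core_conn k p : k < n.+3 -> ~~ has (fun p => p.2 == k.+4) B ->
  p \in core -> good p -> conn (0, k.+4) p.
Proof.
move=> kn kB pc gp.
have via s : core_exit p s -> ~~ has (mem s) B -> conn (0, k.+4) p.
  case/and4P => ps vs s5 /eqP ls /hasPn sB.
  have gs : all good s.
    apply/allP => q qs; rewrite /good (allP vs) //.
    rewrite (leq_trans (allP s5 _ qs)) ?ltn_addl //=.
    by apply/negP => /sB; rewrite inE qs.
  have gl : good (last p s).
    by have := mem_last p s; rewrite inE => /predU1P[->|/(allP gs)].
  apply: (conn_trans gl); last by apply: conn_sym; apply: conn_path.
  case: (last p s) ls gl => i r /= -> /and3P[vi _ iB].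
  apply: ring_conn => //; move: vi; rewrite /valid /= => /orP[|/andP[] //].
  by rewrite !inE !xpair_eqE /= !andbF.
have := fanP pc; case: (fan p) => -[s1 s2] s3 /and5P[e1 e2 e3 d12 /andP[d13 d23]].
have dis : forall q, [/\ ~~ (mem s1 q && mem s2 q), ~~ (mem s1 q && mem s3 q)
    & ~~ (mem s2 q && mem s3 q)].
  move=> q; split; apply/negP => /andP[q1 q2].
  - by case/hasP: d12; exists q.
  - by case/hasP: d13; exists q.
  - by case/hasP: d23; exists q.
by case: (avoid_one_of_three sizeB dis) => /via; apply.
Qed.

Lemma connect_outside (u v : web n) : u \notin S -> v \notin S -> connect e u v.
Proof.
have [k kn kB] := free_row.
(* Every remaining vertex is joined to one fixed point of an intact cycle. *)
have hub w : w \notin S -> conn (0, k.+4) (pos w).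
  move=> /good_pos gw; have /and3P[vw ltw wB] := gw.
  move: (pos w) vw gw ltw wB => p.
  elim/valid_case => {p} [p pc gp _ _|i m i6 _ /= ltm mB].
    exact: core_conn.
  apply: ring_conn => //.
  by move: ltm; rewrite -addn4 -[7]/(3 + 4) addnA ltn_add2r addn3.
have gk : good (0, k.+4).
  apply: good_ring => //; apply: contra kB => k0; apply/hasP.
  by exists (0, k.+4) => /=.
move=> uS vS; exact: (conn_trans gk (conn_sym (hub u uS)) (hub v vS)).
Qed.

End Connectivity.

Lemma web_3_connected n : k_connected 3 (web n).
Proof.
split; first by rewrite card_web.
by move=> S S2 x y; apply: connect_outside.
Qed.

(* The point at radius r on ray i is joined to the one at radius s on ray i + 1. *)
Definition rung (i r s : nat) : bool :=
  (r == s) && (3 < r) ||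
  ((r, s) \in if odd i then [:: (2, 1); (2, 3)] else [:: (1, 2); (3, 2)]).

(** Edges oriented outwards or towards the next ray. All six rays are included from the centre on,
    so this is a plane graph containing the web. *)
Inductive edge : nat * nat -> nat * nat -> Prop :=
| Hub i : i < 6 -> edge (0, 0) (i, 1)
| Spoke i r : i < 6 -> edge (i, r.+1) (i, r.+2)
| Rung i r s : i < 6 -> rung i r s -> edge (i, r) (turn i 1, s).

Lemma nb_edge u v : valid u -> v \in nb u -> edge u v \/ edge v u.
Proof.
move: u; apply: valid_case => [u|i k i6].
- rewrite /core !inE; do 9?[case/orP]; move=> /eqP-> /=; rewrite !inE;
  do 3?[case/orP]; move=> /eqP->;
  first [ by left; apply: Hub | by right; apply: Hub
    | by left; apply: Spoke | by right; apply: Spoke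
    | by left; apply: Rung | by right; apply: Rung ].
- rewrite [nb _]/= !inE => /or4P[/eqP->|/eqP->|/eqP->|].
  + by left; apply: Rung => //; rewrite /rung eqxx.
  + right; have := @Rung (turn i 5) k.+4 k.+4; rewrite /rung eqxx => /(_ _ isT).
    rewrite ltn_pmod // => /(_ isT); congr (edge _ (_, _)).
    by move: i i6; apply: lt6P.
  + by left; apply: Spoke.
  + by case: ifP => // _; rewrite inE => /eqP->; right; apply: Spoke.
Qed.

(** Inner rungs between two given rays share their end at radius 2 and reach radius 3 at most; the
    others have equal radii above 3. This nesting prevents crossings. *)
Lemma rung_mono i r s r' s' : rung i r s -> rung i r' s' ->
  (r <= r') && (s <= s') || (r' <= r) && (s' <= s).
Proof.
rewrite /rung => /orP[/andP[/eqP<- r3]|rs] /orP[/andP[/eqP<- r'3]|rs'].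
- by rewrite !andbb leq_total.
- apply/orP; right; move: rs'.
  by case: odd; rewrite !inE => /orP[]/eqP[-> ->];
    apply/andP; split; exact: leq_trans r3.
- apply/orP; left; move: rs.
  by case: odd; rewrite !inE => /orP[]/eqP[-> ->];
    apply/andP; split; exact: leq_trans r'3.
by move: rs rs'; case: odd; rewrite !inE => /orP[]/eqP[-> ->] /orP[]/eqP[-> ->].
Qed.

Lemma rung_gt0 i r s : rung i r s -> (0 < r) && (0 < s).
Proof.
rewrite /rung => /orP[/andP[/eqP<- r3]|]; first by rewrite andbb (leq_trans _ r3).
by case: odd; rewrite !inE => /orP[]/eqP[-> ->].
Qed.

(** * The straight-line drawing *)

Section Drawing.
Import Order.TTheory GRing.Theory Num.Theory.
Import numFieldNormedType.Exports.
Local Open Scope classical_set_scope.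
Local Open Scope ring_scope.
Variable R : realType.

Definition segment_point (a b : R * R) (t : R) : R * R :=
  (a.1 + t * (b.1 - a.1), a.2 + t * (b.2 - a.2)).

Definition segment (a b : R * R) : set (R * R) := segment_point a b @` `[0, 1].

Lemma segmentC a b : segment a b = segment b a.
Proof.
suff H c d : segment c d `<=` segment d c by apply/seteqP; split; apply: H.
move=> z [t /=]; rewrite in_itv /= => t01 <-; exists (1 - t).
  by rewrite /= in_itv /=; lra.
by rewrite /segment_point; congr pair; ring.
Qed.

Lemma segment_arc a b : a != b -> is_arc (segment a b) a b.
Proof.
move=> ab; exists (segment_point a b); split => //.
- have affine (c d : R) : continuous (fun t : R => c + t * d).
    move=> t; apply: cvgD; first exact: cvg_cst.
    by apply: cvgM; [exact: cvg_id | exact: cvg_cst].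
  apply: continuous_subspaceT => t.
  exact: (cvg_pair (affine _ _ t) (affine _ _ t)).
- move=> s t _ _ [/addrI + /addrI].
  have : (b.1 - a.1 != 0) || (b.2 - a.2 != 0).
    rewrite -negb_and !subr_eq0; apply: contra ab => /andP[/eqP e1 /eqP e2].
    by rewrite [a]surjective_pairing [b]surjective_pairing e1 e2.
  by case/orP => ne; [move=> + _|move=> _]; apply: mulIf.
- by case: a b {ab} => ? ? [? ?]; rewrite /segment_point !mul0r !addr0.
- by case: a b {ab} => ? ? [? ?]; rewrite /segment_point !mul1r !subrKC.
Qed.

(* [s d_i + t d_(i+1)], where d_0, ..., d_5 are the hexagonal directions (1, 0),
   (1, 1), (0, 1), (-1, 0), (-1, -1), (0, -1). *)
Definition cone (i : nat) (s t : R) : R * R :=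
  match i with
  | 0 => (s + t, t)
  | 1 => (s, s + t)
  | 2 => (- t, s)
  | 3 => (- s - t, - t)
  | 4 => (- s, - s - t)
  | _ => (t, - s)
  end.

(* The half-open cones [s > 0, t >= 0] partition the plane without the origin. *)
Lemma cone_inj i j s t s' t' : (i < 6)%N -> (j < 6)%N ->
  0 < s -> 0 <= t -> 0 < s' -> 0 <= t' -> cone i s t = cone j s' t' ->
  [/\ i = j, s = s' & t = t'].
Proof.
move=> i6 j6 s0 t0 s'0 t'0.
move: i i6; apply: lt6P; move: j j6; apply: lt6P; rewrite /cone => -[e1 e2].
all: by first [exfalso; lra | split => //; lra].
Qed.

Lemma cone_neq0 i s t : (i < 6)%N -> 0 < s -> 0 <= t -> cone i s t <> (0, 0).
Proof. by move=> + s0 t0; move: i; apply: lt6P; rewrite /cone => -[e1 e2]; lra. Qed.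

Lemma cone0 i : cone i 0 0 = (0, 0).
Proof. by case: i => [|[|[|[|[|?]]]]]; rewrite /= ?oppr0 ?addr0. Qed.

(** Consecutive cones share a ray, so both ends of a rung have coordinates in cone i. *)
Lemma cone_turn i s : (i < 6)%N -> cone (turn i 1) s 0 = cone i 0 s.
Proof.
by move: i; apply: lt6P; rewrite /cone /= ?oppr0 ?addr0 ?add0r.
Qed.

Lemma segment_point_cone i s t s' t' x :
  segment_point (cone i s t) (cone i s' t') x =
  cone i (s + x * (s' - s)) (t + x * (t' - t)).
Proof.
by case: i => [|[|[|[|[|?]]]]]; rewrite /segment_point /=; congr pair; ring.
Qed.

Definition place (p : nat * nat) : R * R := cone p.1 p.2%:R 0.

(* The points of an edge other than its ends, in cone coordinates; a rung from
   radius r to radius r' is the line s / r + t / r' = 1. *)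
Inductive mid : nat * nat -> nat * nat -> R * R -> Prop :=
| MidSpoke i r s : (i < 6)%N -> r%:R < s < r.+1%:R ->
    mid (if r == 0%N then (0, 0)%N else (i, r)) (i, r.+1) (cone i s 0)
| MidRung i r r' s t : (i < 6)%N -> rung i r r' -> 0 < s -> 0 < t ->
    s * r'%:R + t * r%:R = r%:R * r'%:R ->
    mid (i, r) (turn i 1, r') (cone i s t).

Lemma segment_mid u v z : edge u v -> segment (place u) (place v) z ->
  [\/ z = place u, z = place v | mid u v z].
Proof.
move=> uv [x]; rewrite /= in_itv /= => /andP[x0 x1] <-.
have [->|xn0] := eqVneq x 0.
  by constructor 1; rewrite /segment_point !mul0r !addr0 -surjective_pairing.
have [->|xn1] := eqVneq x 1.
  by constructor 2; rewrite /segment_point !mul1r !subrKC -surjective_pairing.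
have {x0 xn0} x0 : 0 < x by rewrite lt_neqAle eq_sym xn0.
have {x1 xn1} x1 : x < 1 by rewrite lt_neqAle xn1.
constructor 3; case: uv => [i i6|i r i6|i r s i6 rs]; rewrite /place /=.
(* A hub edge is the case r = 0 of [MidSpoke], whose inner end is the centre. *)
- have := @MidSpoke i 0 x i6; rewrite x0 x1 => /(_ isT).
  rewrite (_ : (0 + 0, 0) = cone i 0 0 :> R * R); last by rewrite cone0 addr0.
  by rewrite segment_point_cone; congr (mid _ _ (cone _ _ _)); ring.
- rewrite segment_point_cone subrr mulr0 addr0; apply: (@MidSpoke i r.+1) => //.
  by rewrite -[r.+2]addn1 natrD; lra.
rewrite cone_turn // segment_point_cone; have /andP[r0 s0] := rung_gt0 rs.
have {}r0 : 0 < r%:R :> R by rewrite ltr0n.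
have {}s0 : 0 < s%:R :> R by rewrite ltr0n.
apply: MidRung => //; last by ring.
- by rewrite sub0r mulrN -{1}[r%:R]mul1r -mulrBl mulr_gt0 // subr_gt0.
- by rewrite add0r subr0 mulr_gt0.
Qed.

Lemma pos_comb_eq0 (a b x y : R) : 0 < a -> 0 < b -> 0 <= x -> 0 <= y ->
  a * x + b * y = 0 -> x = 0 /\ y = 0.
Proof.
move=> a0 b0 x0 y0 /eqP; rewrite paddr_eq0 ?mulr_ge0 // ?(ltW a0) ?(ltW b0) //.
by rewrite !mulf_eq0 (gt_eqF a0) (gt_eqF b0) //= => /andP[/eqP-> /eqP->].
Qed.

(** No two edges cross. Cone coordinates of a common point fix i; t = 0 on spokes and t > 0 on
    rungs; on a ray, r < s < r + 1 determines r. *)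
Lemma mid_inj u v z u' v' z' : mid u v z -> mid u' v' z' -> z = z' ->
  u = u' /\ v = v'.
Proof.
have spoke_gt0 r (s : R) : r%:R < s -> 0 < s by apply: le_lt_trans; exact: ler0n.
case=> [i r s i6 /andP[rs sr]|i r r1 s t i6 rr s0 t0 e];
case=> [j q s' j6 /andP[qs sq]|j q q1 s' t' j6 qq s'0 t'0 e'] zz.
- have [<- ss _] := cone_inj i6 j6 (spoke_gt0 _ _ rs) (lexx _)
                               (spoke_gt0 _ _ qs) (lexx _) zz.
  suff -> : r = q by [].
  rewrite -ss in qs sq.
  apply/eqP; rewrite eqn_leq; apply/andP; split; rewrite -ltnS -(ltr_nat R).
    exact: lt_trans rs sq.
  exact: lt_trans qs sr.
- have [_ _ t0] := cone_inj i6 j6 (spoke_gt0 _ _ rs) (lexx _) s'0 (ltW t'0) zz.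
  by rewrite -t0 ltxx in t'0.
- have [_ _ t'0] := cone_inj i6 j6 s0 (ltW t0) (spoke_gt0 _ _ qs) (lexx _) zz.
  by rewrite t'0 ltxx in t0.
have [ij ss tt] := cone_inj i6 j6 s0 (ltW t0) s'0 (ltW t'0) zz.
rewrite -ss -tt -ij in qq e' *.
suff [-> ->] : r = q /\ r1 = q1 by [].
have /andP[] := rung_gt0 rr; have /andP[] := rung_gt0 qq.
rewrite -!(ltr_nat R) => q0 q10 r0 r10.
(* Two rungs over the same pair of rays are nested, so both summands below have
   the same sign and vanish. *)
have key : s * (r1%:R * q1%:R) * (q%:R - r%:R)
         + t * (r%:R * q%:R) * (q1%:R - r1%:R) = 0.
  transitivity ((s * r1%:R + t * r%:R) * (q%:R * q1%:R)
              - (s * q1%:R + t * q%:R) * (r%:R * r1%:R)); first by ring.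
  by rewrite e e'; ring.
have c1 : 0 < s * (r1%:R * q1%:R) by rewrite !mulr_gt0.
have c2 : 0 < t * (r%:R * q%:R) by rewrite !mulr_gt0.
have : q%:R - r%:R = 0 :> R /\ q1%:R - r1%:R = 0 :> R.
  have := rung_mono rr qq; rewrite -!(ler_nat R) => /orP[]/andP[h1 h2].
    by apply: (pos_comb_eq0 c1 c2 _ _ key); rewrite subr_ge0.
  have hr : 0 <= r%:R - q%:R :> R by rewrite subr_ge0.
  have hr1 : 0 <= r1%:R - q1%:R :> R by rewrite subr_ge0.
  have [|/subr0_eq-> /subr0_eq->] := pos_comb_eq0 c1 c2 hr hr1.
    by rewrite -(opprB q%:R) -(opprB q1%:R) !mulrN -opprD key oppr0.
  by rewrite !subrr.
by case=> /subr0_eq/eqP + /subr0_eq/eqP; rewrite !eqr_nat => /eqP-> /eqP->.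
Qed.

Lemma place_cases p : valid p ->
  p = (0, 0)%N \/ [/\ (p.1 < 6)%N, 0 < p.2%:R :> R & place p = cone p.1 p.2%:R 0].
Proof.
move=> vp; suff : (p == (0, 0)%N) || (p.1 < 6)%N && (0 < p.2)%N.
  by case/predU1P => [->|/andP[? ?]]; [left|right; split => //; rewrite ltr0n].
move: p vp; apply: valid_case => [p|i k /= ->]; last by rewrite orbT.
by move: p; apply/allP; vm_compute.
Qed.

Lemma place_inj p q : valid p -> valid q -> place p = place q -> p = q.
Proof.
move=> vp vq.
have pl0 : place (0, 0)%N = (0, 0) by exact: cone0.
have [->|[p6 p0 ep]] := place_cases vp;
  have [->|[q6 q0 eq]] := place_cases vq => //.
- by rewrite eq pl0 => /esym/cone_neq0; case.
- by rewrite ep pl0 => /cone_neq0; case.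
rewrite ep eq => /cone_inj[] // e1 /eqP; rewrite eqr_nat => /eqP e2 _.
by rewrite [p]surjective_pairing e1 e2 -surjective_pairing.
Qed.

(** A vertex other than the centre has t = 0 and an integer s, whereas inside an edge either s lies
    strictly between consecutive integers or t > 0. *)
Lemma place_not_mid u v p : valid p -> ~ mid u v (place p).
Proof.
move=> vp; move ez: (place p) => z m; case: m ez => {u v z}.
- move=> i r s i6 /andP[rs sr].
  have s0 : 0 < s by apply: le_lt_trans rs; exact: ler0n.
  have [->|[p6 p0 ->]] := place_cases vp.
    by rewrite /place cone0 => /esym/cone_neq0; case.
  move=> /cone_inj[] // _ ps _; move: rs sr; rewrite -ps !ltr_nat ltnS.
  by rewrite ltnNge => /negP.
- move=> i r r' s t i6 _ s0 t0 _.
  have [->|[p6 p0 ->]] := place_cases vp.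
    by rewrite /place cone0 => /esym/cone_neq0; case => //; exact: ltW.
  case/(cone_inj p6 i6 p0 (lexx _) s0 (ltW t0)) => _ _ te.
  by rewrite -te ltxx in t0.
Qed.

Lemma web_planar n : planar R (web n).
Proof.
pose p (x : web n) := place (pos x).
have p_inj : injective p.
  by move=> x y /place_inj e; apply: pos_inj; apply: e; apply: pos_valid.
have seg_cases x y z : adj x y -> segment (p x) (p y) z ->
    [\/ z = p x, z = p y | mid (pos x) (pos y) z \/ mid (pos y) (pos x) z].
  move=> /(nb_edge (pos_valid x))[] e; last rewrite segmentC.
    by case/(segment_mid e); [constructor 1|constructor 2|constructor 3; left].
  by case/(segment_mid e); [constructor 2|constructor 1|constructor 3; right].
exists p, (fun x y => segment (p x) (p y)); split => //.
- move=> x y xy; split; last exact: segmentC.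
  apply: segment_arc; rewrite (inj_eq p_inj); apply: contraTneq xy => ->.
  by rewrite adj_irrefl.
- move=> x y z xy /(seg_cases _ _ _ xy)[/p_inj|/p_inj|]; [by left|by right|].
  by case=> /place_not_mid; case; apply: pos_valid.
move=> x y z w xy zw ne1 ne2 q [/(seg_cases _ _ _ xy) + /(seg_cases _ _ _ zw)].
case=> [->|->|m]; [by exists x|by exists y|].
case=> [->|->|m']; [by exists z|by exists w|].
(* Equal orientations contradict [ne1], opposite ones [ne2]. *)
by exfalso; case: m m' => m [] m';
  case: (mid_inj m m' erefl) => /pos_inj e1 /pos_inj e2;
  [apply: ne1|apply: ne2|apply: ne2|apply: ne1].
Qed.

End Drawing.

Theorem theorem15 (R : realType) :
  exists G : nat -> sgraph,
    (forall i j : nat, i <> j -> ~ isomorphic (G i) (G j)) /\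
    (forall i : nat,
      [/\ k_connected 3 (G i),
          planar R (G i),
          max_degree (G i) = 4,
          has_girth (G i) 4 &
          injective_chromatic_number (G i) = 6]).
Proof.
exists web; split; first exact: web_not_isomorphic.
move=> i; split.
- exact: web_3_connected.
- exact: web_planar.
- exact: web_max_degree.
- exact: web_girth.
- exact: web_injective_chromatic_number.
Qed.
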